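(* Let $U$ and $V$ be lcsc groups with left Haar measures $m_U,m_V$, and let $\{E_T\}_{T>0}\subset U$ and $\{F_S\}_{S>0}\subset V$ be families of compact sets of positive finite Haar measure. Assume: $F_S$ is a Følner family, i.e. $\lim_{S\to\infty}m_V(F_Sv\,\Delta\,F_S)/m_V(F_S)=0$ for all $v\in V$; and the normalized averages $A_Tf=\frac{1}{m_U(E_T)}\int_{E_T}\pi_U(u)f\,dm_U(u)$ and $B_Sf=\frac{1}{m_V(F_S)}\int_{F_S}\pi_V(v)f\,dm_V(v)$ satisfy, in every measure-preserving action on a probability space and for $1<p<\infty$, the strong maximal inequality $\|\sup_T|A_Tf|\|_p\le C_p\|f\|_p$ (resp. for $B_S$) and the pointwise ergodic theorem (convergence a.e. and in $L^p$ to the conditional expectation onto the invariant functions). Let $U$ and $V$ act (separately, with no commutation assumed) by measure-preserving transformations on a probability space $(X,m)$. Then: (1) for $1<p\le\infty$, $\big\|\sup_{T,S>0}|A_TB_Sf|\big\|_p\le C_p'\|f\|_p$; (2) with $\mathcal U,\mathcal V$ the conditional expectations onto the $U$-invariant and $V$-invariant $\sigma$-algebras, for every $f\in L^p(X)$, $1<p<\infty$, $\lim_{\min(T,S)\to\infty}A_TB_Sf(x)=\mathcal U\mathcal Vf(x)$ for a.e. $x$ and in $L^p$-norm; (3) if $U$ or $V$ acts ergodically, the limit equals $\int_X f\,dm$.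
   Context: For a measure-preserving action of a group $H$ on $(X,m)$, $\pi_H(h)f(x)=f(h^{-1}x)$. Note $A_TB_Sf=\frac{1}{m_U(E_T)m_V(F_S)}\int_{E_T}\int_{F_S}\pi_U(u)\pi_V(v)f\,dm_V(v)\,dm_U(u)$. *)

(* Defs.v *)
From HB Require Import structures.
From mathcomp Require Import all_boot all_order all_algebra.
From mathcomp Require Import all_classical all_reals all_analysis.

Set Implicit Arguments.
Unset Strict Implicit.
Unset Printing Implicit Defensive.

Import Order.TTheory GRing.Theory Num.Theory.
Import numFieldNormedType.Exports.

Local Open Scope classical_set_scope.
Local Open Scope ring_scope.

Definition borel (G : ptopologicalType) := g_sigma_algebraType (@open G).

Definition is_lcsc_group (G : ptopologicalType)
    (mul : G -> G -> G) (inv : G -> G) (one : G) : Prop :=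
  [/\ (forall x y z, mul x (mul y z) = mul (mul x y) z),
      (forall x, mul one x = x /\ mul x one = x),
      (forall x, mul (inv x) x = one /\ mul x (inv x) = one),
      (continuous (fun p : G * G => mul p.1 p.2) /\ continuous inv) &
      [/\ hausdorff_space G, locally_compact [set: G] & @second_countable G]].

(* m is a left Haar measure on the Borel sets of G: left invariant, finite on
   compact sets, positive on non-empty open sets (regularity is automatic on
   lcsc spaces). *)
Definition is_left_haar (R : realType) (G : ptopologicalType) (mul : G -> G -> G)
    (m : {measure set (borel G) -> \bar R}) : Prop :=
  [/\ (forall (g : G) (A : set (borel G)), measurable A ->
         m [set mul g a | a in A] = m A),
      (forall K : set G, compact K -> (m K < +oo)%E) &
      (forall O : set G, open O -> O !=set0 -> (0 < m O)%E)].

Definition mp_action (R : realType) (G : ptopologicalType)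
    (mul : G -> G -> G) (one : G)
    (dX : measure_display) (X : measurableType dX)
    (mu : {measure set X -> \bar R}) (act : G -> X -> X) : Prop :=
  [/\ (forall x, act one x = x),
      (forall g h x, act (mul g h) x = act g (act h x)),
      measurable_fun [set: (borel G * X)%type] (fun gx : borel G * X => act gx.1 gx.2),
      (forall g, measurable_fun [set: X] (act g)) &
      (forall g (A : set X), measurable A -> mu (act g @^-1` A) = mu A)].

(* The normalized average  (1/m(E)) \int_E pi(g) f dm(g),  pi(g) f (x) = f (g^{-1} x). *)
Definition avg (R : realType) (G : ptopologicalType) (inv : G -> G)
    (m : {measure set (borel G) -> \bar R}) (E : set G)
    (X : Type) (act : G -> X -> X) (f : X -> R) : X -> R :=
  fun x => (fine (m E))^-1 * Rintegral m E (fun g => f (act (inv g) x)).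

Definition in_Lp (R : realType) (dX : measure_display) (X : measurableType dX)
    (mu : {measure set X -> \bar R}) (p : \bar R) (f : X -> R) : Prop :=
  measurable_fun [set: X] f /\ finite_norm mu p f.

Definition invariant_sets (G : Type) (dX : measure_display) (X : measurableType dX)
    (act : G -> X -> X) : set (set X) :=
  [set A | measurable A /\ forall g, act g @^-1` A = A].

Definition is_cond_exp (R : realType) (dX : measure_display) (X : measurableType dX)
    (mu : {measure set X -> \bar R}) (S : set (set X)) (f g : X -> R) : Prop :=
  [/\ (forall B : set R, measurable B -> S (g @^-1` B)),
      mu.-integrable [set: X] (EFin \o g) &
      (forall A, S A -> (\int[mu]_(x in A) (g x)%:E = \int[mu]_(x in A) (f x)%:E)%E)].

Definition ergodic (R : realType) (G : Type) (dX : measure_display) (X : measurableType dX)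
    (mu : {measure set X -> \bar R}) (act : G -> X -> X) : Prop :=
  forall A, invariant_sets act A -> mu A = 0%E \/ mu A = 1%E.

Definition maxfun (R : realType) (I X : Type) (D : set I) (a : I -> X -> R) : X -> \bar R :=
  fun x => ereal_sup [set (`|a i x|)%:E | i in D].

Definition good_averages (R : realType) (G : ptopologicalType)
    (mul : G -> G -> G) (inv : G -> G) (one : G)
    (m : {measure set (borel G) -> \bar R}) (E : R -> set G) : Prop :=
  forall (dY : measure_display) (Y : measurableType dY) (P : probability Y R)
         (act : G -> Y -> Y), mp_action mul one P act ->
  forall p : R, 1 < p ->
  (exists C : R, forall f, in_Lp P p%:E f ->
      (Lnorm P p%:E (maxfun [set T : R | (0 < T)%R] (fun T => avg inv m (E T) act f))
        <= C%:E * Lnorm P p%:E (EFin \o f))%E) /\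
  (forall f, in_Lp P p%:E f ->
   forall h, is_cond_exp P (invariant_sets act) f h ->
     {ae P, forall y, avg inv m (E T) act f y @[T --> +oo] --> h y} /\
     (Lnorm P p%:E (EFin \o (avg inv m (E T) act f \- h)) @[T --> +oo] --> 0%E)).

Definition symdiff (T : Type) (A B : set T) : set T := (A `\` B) `|` (B `\` A).

(* The filter "min(T, S) -> +oo" on pairs of reals: product of two +oo filters. *)
Definition pinfty2 (R : realType) : set_system (R * R) :=
  filter_prod (pinfty_nbhs R) (pinfty_nbhs R).

Definition ATBS (R : realType) (U V : ptopologicalType) (invU : U -> U) (invV : V -> V)
    (mU : {measure set (borel U) -> \bar R}) (mV : {measure set (borel V) -> \bar R})
    (E : R -> set U) (F : R -> set V) (X : Type)
    (actU : U -> X -> X) (actV : V -> X -> X) (f : X -> R) (TS : R * R) : X -> R :=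
  avg invU mU (E TS.1) actU (avg invV mV (F TS.2) actV f).

(* Main.v *)
(* The average B_S f is controlled, for almost every x and for all S at once, by
   a single function g in L^p.  Hence |A_T B_S f| <= A_T g almost everywhere, for
   all T and S at once, and the maximal inequality for A_T applied to g gives (1).
   For (2) replace B_S f by B_S f - V f with S > N: it is dominated by some h_N
   whose L^p norm tends to 0 by dominated convergence, so A_T B_S f - A_T V f is
   dominated by the maximal function of h_N, while A_T V f -> U V f by hypothesis.
   In (3) an ergodic action has constant conditional expectations.

   Nothing is assumed on the dependence of E_T on T, so suprema over T could fail
   to be measurable.  Since the measure algebra of an lcsc group is separable,
   there are countably many indices such that, along almost every orbit, the
   supremum over all T is the supremum over these indices. *)
Require Import Defs.
From HB Require Import structures.
From mathcomp Require Import all_boot all_order all_algebra.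
From mathcomp Require Import all_classical all_reals all_analysis.
From mathcomp Require Import measurable_realfun ess_sup_inf.

Import Order.TTheory GRing.Theory Num.Theory.
Import numFieldNormedType.Exports.

Local Open Scope classical_set_scope.
Local Open Scope ring_scope.

Set Implicit Arguments.
Unset Strict Implicit.
Unset Printing Implicit Defensive.

(** * Norms of possibly non-measurable functions, and orbit integrals *)

Section norms.
Context {R : realType} {d} {T : measurableType d}.
Implicit Types (mu : {measure set T -> \bar R}).
Local Open Scope ereal_scope.
Import HBNNSimple.

(* Neither function need be measurable: the integral of a nonnegative function is
   the supremum of the integrals of the simple functions below it. *)
Lemma ae_le_integral mu (f g : T -> \bar R) :
  (forall x, 0 <= f x) -> (forall x, 0 <= g x) ->
  {ae mu, forall x, f x <= g x} -> \int[mu]_x f x <= \int[mu]_x g x.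
Proof.
move=> f0 g0 [N [mN muN subN]].
rewrite ge0_integralTE//; apply: ge_ereal_sup => _ /= [h hf <-].
rewrite -integralT_nnsfun.
(* Setting [h] to 0 on the null set [N] keeps its integral and puts it below [g] everywhere, so it
   competes in the supremum defining the integral of [g]. *)
pose h' := proj_nnsfun h (measurableC mN).
have h'E x : h' x = (h x * \1_(~` N) x)%R by [].
have -> : \int[mu]_x (h x)%:E = \int[mu]_x (h' x)%:E.
  apply: ae_eq_integral => //; [exact/measurable_EFinP..|].
  exists N; split => // x /= hx; apply: contrapT => Nx; apply: hx => _.
  by congr EFin; rewrite [RHS]h'E indicE mem_set// mulr1.
rewrite integralT_nnsfun ge0_integralTE//.
apply: ereal_sup_ubound; exists h' => // x.
rewrite h'E indicE; have [Nx|Nx] := pselect (N x).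
  by rewrite memNset ?mulr0//=; apply.
rewrite mem_set// mulr1 (le_trans (hf x))//.
by apply: contrapT => hx; apply: Nx; exact: subN.
Qed.

(** Allows a maximal function over an uncountable index set, possibly non-measurable, to be bounded
    in norm by a measurable majorant. *)
Lemma ae_le_Lnorm mu (p : \bar R) (f g : T -> \bar R) : 0 < p ->
  {ae mu, forall x, `|f x| <= `|g x|} -> Lnorm mu p f <= Lnorm mu p g.
Proof.
rewrite unlock; case: p => [p| |//] p0 fg.
  rewrite gt0_ler_poweR//.
  - by rewrite invr_ge0 ltW.
  - by rewrite in_itv/= leey andbT integral_ge0// => x _; exact: poweR_ge0.
  - by rewrite in_itv/= leey andbT integral_ge0// => x _; exact: poweR_ge0.
  apply: ae_le_integral => [x|x|]; [exact: poweR_ge0..|].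
  apply: filterS fg => x fgx; apply: gt0_ler_poweR => //.
  - exact: ltW.
  - by rewrite in_itv/= leey andbT.
  - by rewrite in_itv/= leey andbT.
case: ifPn => // _; exact: le_ess_sup.
Qed.

Lemma ae_eq_Lnorm mu (p : \bar R) (f g : T -> \bar R) : 0 < p ->
  {ae mu, forall x, f x = g x} -> Lnorm mu p f = Lnorm mu p g.
Proof.
move=> p0 fg; apply/eqP; rewrite eq_le; apply/andP; split;
  by apply: ae_le_Lnorm => //; apply: filterS fg => x ->.
Qed.

Lemma Lnorm_lty_ae mu (p : R) (f : T -> \bar R) : (0 < p)%R ->
  measurable_fun setT f -> Lnorm mu p%:E f < +oo ->
  {ae mu, forall x, f x \is a fin_num}.
Proof.
move=> p0 mf fy.
have : mu.-integrable setT (fun x => `|f x| `^ p).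
  apply/integrableP; split.
    apply: (@measurableT_comp _ _ _ _ _ _ (fun x => x `^ p)) => //.
      exact: measurable_poweR.
    exact: measurableT_comp.
  under eq_integral do rewrite gee0_abs ?poweR_ge0//.
  by rewrite -poweR_Lnorm ?gt_eqF// poweR_lty.
move/integrable_ae => /(_ measurableT); apply: filterS => x /= /(_ I).
by case: (f x) => [r| |] //=; rewrite gt_eqF.
Qed.

End norms.

Lemma in_Lp_integrable {R : realType} {d} {T : measurableType d}
    (P : probability T R) (p : \bar R) (f : T -> R) : (1 <= p)%E ->
  in_Lp P p f -> P.-integrable setT (EFin \o f).
Proof.
move=> p1 [mf ff].
have P1 : P [set: T] \is a fin_num by rewrite fin_num_measure.
have : f \in Lfun P p by rewrite inE; apply/andP; split; rewrite inE.
by move/(Lfun_subset (lexx 1%E) p1 P1 p1)/Lfun1_integrable.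
Qed.

(** Fubini and Tonelli take a bundled sigma-finite measure; this bundle is built on [m] itself, so
    integrals against the two are convertible. *)
Definition sigma_finite_pack {R : realType} {d} {T : measurableType d}
    (m : {measure set T -> \bar R}) (mT : sigma_finite setT m) :
    {sigma_finite_measure set T -> \bar R} :=
  HB.pack_for (sigma_finite_measure T R) (Measure.sort m)
    (isSFinite.Build _ _ _ (Measure.sort m) (sfinite_measure_sigma_finite mT))
    (isSigmaFinite.Build _ _ _ (Measure.sort m) mT).

(** * Fubini along the orbits of a family of measure-preserving maps *)

Section orbit.
Context {R : realType} {dG} {G : measurableType dG} {dX} {X : measurableType dX}.
Variables (mu : {sigma_finite_measure set G -> \bar R}) (P : probability X R).
Variable (a : G -> X -> X).
Hypothesis ma : measurable_fun setT (fun gx : G * X => a gx.1 gx.2).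
Hypothesis pa : forall g A, measurable A -> P (a g @^-1` A) = P A.

Let ma1 g : measurable_fun setT (a g).
Proof. exact: (measurableT_comp ma (measurable_pair1 g)). Qed.

Lemma orbit_measurable x : measurable_fun setT (a ^~ x).
Proof. exact: (measurableT_comp ma (measurable_pair2 x)). Qed.

(** Tonelli for the set of pairs with [a g x] in the null set [N]: for fixed [g] the section has
    measure [P N = 0] by invariance, hence for almost every [x] the section in [G] is null. *)
Lemma orbit_ae (Q : X -> Prop) : {ae P, forall x, Q x} ->
  {ae P, forall x, {ae mu, forall g, Q (a g x)}}.
Proof.
move=> [N [mN PN QN]].
pose B : set (G * X) := (fun gx => a gx.1 gx.2) @^-1` N.
have mB : measurable B by rewrite -[B]setTI; exact: ma.
have := indic_fubini_tonelli mu P mB.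
rewrite indic_fubini_tonelli_FE// indic_fubini_tonelli_GE//.
rewrite [X in X = _ -> _]integral0_eq; last first.
  move=> g _ /=; rewrite -[RHS]PN -(pa g mN); congr (P _).
  by apply/seteqP; split => x; rewrite /xsection/= inE.
move/esym => int0.
have : (\int[P]_x `|(mu \o ysection B) x| = 0)%E.
  by under eq_integral do rewrite gee0_abs//.
move/ae_eq_integral_abs => /(_ measurableT (measurable_fun_ysection _ mB)).
apply: filterS => x /(_ I) /= yB0.
exists (ysection B x); split => //; first exact: measurable_ysection.
by move=> g /= Qg; rewrite /ysection/= inE; exact: QN.
Qed.

(** By Tonelli and invariance, the integral over [X] of the orbit integrals of [|f|] over [K] is
    [mu K] times the L^1 norm of [f], so almost every orbit integral is finite. *)
Lemma orbit_integrable (f : X -> R) (K : set G) :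
  measurable K -> (mu K < +oo)%E -> P.-integrable setT (EFin \o f) ->
  {ae P, forall x, mu.-integrable K (fun g => (f (a g x))%:E)}.
Proof.
move=> mK Koo /integrableP[mf intf].
pose phi (gx : G * X) := ((`|f (a gx.1 gx.2)| * \1_K gx.1)%:E).
have mphi : measurable_fun setT phi.
  apply/measurable_EFinP; apply: measurable_funM.
    apply: measurableT_comp => //; apply: (measurableT_comp _ ma).
    exact/measurable_EFinP.
  by apply: measurableT_comp.
have phi0 gx : (0 <= phi gx)%E by rewrite lee_fin mulr_ge0.
have := @fubini_tonelli2 _ _ _ _ _ mu P _ mphi phi0.
rewrite (@fubini_tonelli1 _ _ _ _ _ mu P _ mphi phi0).
have -> : (\int[mu]_g (fubini_F P phi g) = \int[P]_x `|f x|%:E * mu K)%E.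
  transitivity (\int[mu]_(g in K) (cst (\int[P]_x `|f x|%:E) g))%E; last first.
    by rewrite integral_cst.
  rewrite [RHS]integral_mkcond; apply: eq_integral => g _.
  rewrite /fubini_F /phi /= patchE indicE; case: ifPn => _; last first.
    by under eq_integral do rewrite mulr0; rewrite integral0.
  under eq_integral do rewrite mulr1.
  have := @ge0_integral_pushforward _ _ _ _ R _ (ma1 g) P setT
    (fun x => `|f x|%:E) measurableT.
  rewrite preimage_setT => <-//; first 1 last.
    by do 2 apply: measurableT_comp => //; apply/measurable_EFinP.
  by apply: eq_measure_integral => A mA _; exact: pa.
move=> intG.
have : P.-integrable setT (fubini_G mu phi).
  apply/integrableP; split; first exact: measurable_fun_fubini_tonelli_G.
  under eq_integral.
    move=> x _; rewrite gee0_abs; last by apply: integral_ge0.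
    over.
  by rewrite -intG lte_mul_pinfty ?integral_ge0// ge0_fin_numE ?integral_ge0.
move/integrable_ae => /(_ measurableT); apply: filterS => x /= /(_ I) fin.
apply/integrableP; split.
  apply/measurable_funTS/measurable_EFinP.
  apply: (measurableT_comp _ (orbit_measurable x)); exact/measurable_EFinP.
rewrite integral_mkcond ltey_eq; apply/orP; left.
rewrite (_ : integral _ _ _ = fubini_G mu phi x)//.
apply: eq_integral => g _; rewrite /phi/= restrict_EFin//.
by rewrite /= patchE indicE; case: ifPn; rewrite ?(mulr1,mulr0)// normr0.
Qed.

(** Tonelli makes the integrals of the positive and negative parts measurable without any
    integrability; [fine] then gives the value 0 wherever their difference is infinite. *)
Lemma measurable_orbit_Rintegral (f : X -> R) (K : set G) :
  measurable_fun setT f -> measurable K ->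
  measurable_fun setT (fun x => Rintegral mu K (fun g => f (a g x))).
Proof.
move=> mf mK.
pose phi (gx : G * X) := ((f (a gx.1 gx.2) * \1_K gx.1)%:E).
have mphi : measurable_fun setT phi.
  apply/measurable_EFinP; apply: measurable_funM.
    exact: (measurableT_comp _ ma).
  by apply: measurableT_comp.
rewrite (_ : (fun x => _) = (fun x => fine
    (fubini_G mu phi^\+ x - fubini_G mu phi^\- x)))%E; last first.
  apply/funext => x; rewrite Rintegral_mkcond /Rintegral integralE.
  congr (fine (_ - _)); apply: eq_integral => g _.
    by rewrite /phi !funeposE/= patchE indicE; case: ifPn; rewrite ?(mulr1,mulr0).
  by rewrite /phi !funenegE/= patchE indicE; case: ifPn; rewrite ?(mulr1,mulr0).
apply: (measurableT_comp (@fine_measurable R setT measurableT)) => //; apply: emeasurable_funB.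
  apply: measurable_fun_fubini_tonelli_G => //; exact: measurable_funepos.
apply: measurable_fun_fubini_tonelli_G => //; exact: measurable_funeneg.
Qed.

End orbit.

(** * Separability of families of compact sets *)

Lemma second_countable_basis (G : topologicalType) : @second_countable G ->
  exists b : nat -> set G, (forall n, open (b n)) /\
    forall x A, nbhs x A -> exists n, b n x /\ b n `<=` A.
Proof.
case=> B /countable_injP[f finj] [oB bB].
(* Injectivity of [f] on [B] makes the basic set with code [n] unique; an integer that codes none
   gets the empty set. *)
have /choice[b bP] n : exists Z : set G, open Z /\ forall Z', B Z' -> f Z' = n -> Z = Z'.
  have [[Z [BZ fZ]]|nZ] := pselect (exists Z, B Z /\ f Z = n).
    exists Z; split; first exact: oB.
    by move=> Z' BZ' fZ'; apply: finj; rewrite ?inE// fZ.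
  by exists set0; split; [exact: open0|move=> Z' BZ' fZ'; case: nZ; exists Z'].
exists b; split=> [n|x A /bB [Z [BZ Zx] ZA]]; first by case: (bP n).
by exists (f Z); rewrite (proj2 (bP (f Z)) Z BZ erefl).
Qed.

Lemma compact_seq_cover (G : ptopologicalType) (b : nat -> set G) (C : set G)
    (P : nat -> Prop) : (forall n, open (b n)) -> compact C ->
  (forall x, C x -> exists n, P n /\ b n x) ->
  exists s : seq nat, (forall n, n \in s -> P n) /\
    C `<=` \bigcup_(n in [set` s]) b n.
Proof.
move=> ob; rewrite (@compact_cover G) => cC cov.
have [//|x /cov[n [Pn bn]]|D DP Dcov] := cC nat [set n | P n] b.
  by exists n.
exists (finmap.enum_fset D); split => [n nD|x /Dcov[n nD bn]]; last by exists n.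
by have := DP n nD; rewrite inE.
Qed.

Lemma precompact_basis (G : ptopologicalType) (b : nat -> set G) :
  locally_compact [set: G] ->
  (forall x A, nbhs x A -> exists n, b n x /\ b n `<=` A) ->
  forall x, exists n, compact (closure (b n)) /\ b n x.
Proof.
move=> lcG bP x; have [N] := @lcG x I; rewrite withinET => Nx [cN clN].
have [n [bx bN]] := bP x N Nx; exists n; split => //.
apply: subclosed_compact cN _; first exact: closed_closure.
by apply: (subset_trans (closure_subset bN)); rewrite -(closure_id _).1.
Qed.

(** The partial unions of the compact closures of basic sets exhaust: finitely many basic sets of
    compact closure cover a given compact set. *)
Lemma compact_exhaustion (G : ptopologicalType) :
  locally_compact [set: G] -> @second_countable G ->
  exists K : nat -> set G, (forall n, compact (K n)) /\
    forall C, compact C -> exists n, C `<=` K n.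
Proof.
move=> lcG /second_countable_basis[b [ob bP]].
pose c n := if `[< compact (closure (b n)) >] then closure (b n) else set0.
exists (fun n => \big[setU/set0]_(i < n) c i); split => [n|C cC].
  apply: bigsetU_compact => i _; rewrite /c; case: asboolP => // _.
  exact: compact0.
have [x _|s [sP Cs]] :=
    @compact_seq_cover G b C (fun n => compact (closure (b n))) ob cC.
  exact: precompact_basis.
exists (\max_(i <- s) i).+1 => x /Cs[n /= ns bn].
rewrite -bigcup_mkord; exists n; first by rewrite /= ltnS; exact: leq_bigmax_seq.
by rewrite /c asboolT; [exact: subset_closure|exact: sP].
Qed.

Section lcsc_measure.
Context {R : realType} {G : ptopologicalType}.
Hypotheses (hG : hausdorff_space G) (lcG : locally_compact [set: G])
  (scG : @second_countable G).
Variable m : {measure set (borel G) -> \bar R}.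
Hypothesis mfin : forall K : set G, compact K -> (m K < +oo)%E.

Lemma open_measurable_borel (A : set G) : open A -> measurable (A : set (borel G)).
Proof. by move=> oA; exact: sub_sigma_algebra. Qed.

Lemma compact_measurable_borel (A : set G) :
  compact A -> measurable (A : set (borel G)).
Proof.
move=> /(compact_closed hG) cA; rewrite -[A]setCK; apply: measurableC.
by apply: open_measurable_borel; exact: closed_openC.
Qed.

Lemma lcsc_sigma_finite : sigma_finite [set: borel G] m.
Proof.
have [K [cK KP]] := compact_exhaustion lcG scG.
exists K => [|n]; last by split; [exact: compact_measurable_borel|exact: mfin].
apply/seteqP; split => // x _.
by have [n /(_ x erefl) Kx] := KP _ (@compact_set1 G x); exists n.
Qed.

(** Outer regularity by members of a countable family. The finite unions of basic sets that cover
    [F] intersect in [F], so their decreasing partial intersections, inside one of finite measure,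
    have measure tending to [m F]. Compactness then fits a finite union between [F] and such an
    intersection. *)
Lemma compact_outer_approx (b : nat -> set G) (F : set G) (e : R) :
  (forall n, open (b n)) ->
  (forall x A, nbhs x A -> exists n, b n x /\ b n `<=` A) ->
  compact F -> 0 < e -> exists s : seq nat,
    F `<=` \bigcup_(n in [set` s]) b n /\
    (m ((\bigcup_(n in [set` s]) b n) `\` F) < e%:E)%E.
Proof.
move=> ob bP cF e0; pose W (s : seq nat) := \bigcup_(n in [set` s]) b n.
have oW s : open (W s) by apply: bigcup_open => n _; exact: ob.
have mF := compact_measurable_borel cF.
have [s0 [FW0 W0oo]] : exists s, F `<=` W s /\ (m (W s) < +oo)%E.
  have [x _|s [sP Fs]] :=
      @compact_seq_cover G b F (fun n => compact (closure (b n))) ob cF.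
    exact: precompact_basis.
  exists s; split => //.
  pose C := \big[setU/set0]_(i <- s | i \in s) closure (b i).
  have cC : compact C by exact: bigsetU_compact.
  rewrite (@le_lt_trans _ _ (m C))//; last exact: mfin.
  apply: le_measure; rewrite ?inE.
  - exact: open_measurable_borel.
  - exact: compact_measurable_borel.
  - move=> x [n /= ns bn]; rewrite /C -big_seq -bigcup_seq.
    exists n => //; exact: subset_closure.
(* Enumerates the finite unions that cover [F], with [s0] as default for all other codes. *)
pose t n := if unpickle n is Some s then
  (if `[< F `<=` W s >] then s else s0) else s0.
have Ft n : F `<=` W (t n).
  by rewrite /t; case: unpickle => [s|//]; case: asboolP.
pose V n := W s0 `&` \bigcap_(i in `I_n) W (t i).
have oV n : open (V n).
  apply: openI => //; rewrite bigcap_mkord.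
  by elim/big_ind: _ => //; [exact: openT|exact: openI].
have FV n : F `<=` V n by move=> x Fx; split; [exact: FW0|move=> i _; exact: Ft].
have capV : \bigcap_n V n = F.
  apply/seteqP; split => x; last by move=> Fx n _; exact: FV.
  move=> Vx; apply: contrapT => Fx.
  have [y Fy|s [sP Fs]] :=
      @compact_seq_cover G b F (fun n => ~ closure (b n) x) ob cF.
    have yx : y != x by apply/eqP => yx; apply: Fx; rewrite -yx.
    have := hG; rewrite open_hausdorff => /(_ _ _ yx)[[A B]]/= [].
    rewrite !inE => Ay Bx [oA oB AB0].
    have [n [bny bnA]] := bP y A (open_nbhs_nbhs (conj oA Ay)).
    exists n; split => // /(_ B (open_nbhs_nbhs (conj oB Bx)))[z [bnz Bz]].
    have : (A `&` B) z by split => //; exact: bnA.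
    by rewrite AB0.
  (* Each [y] in [F] has a basic neighbourhood whose closure misses [x], so some cover [W s] misses
     [x]. The successor is needed because [V n] only intersects over indices below [n]. *)
  have [_] := Vx (pickle s).+1 I.
  move=> /(_ (pickle s) (ltnSn _)).
  rewrite /t pickleK asboolT// => -[n /= ns bn].
  by apply: (sP n ns); exact: subset_closure.
have mV n : measurable (V n : set (borel G)) by exact: open_measurable_borel.
have niV : nonincreasing_seq (V : nat -> set (borel G)).
  move=> n k nk; apply/subsetPset => x [W0x Wx]; split => // i /= ik.
  by apply: Wx => /=; exact: leq_trans nk.
have Voo n : (m (V n) < +oo)%E.
  apply: le_lt_trans W0oo; apply: le_measure; rewrite ?inE//.
    exact: open_measurable_borel.
  by move=> x [].
have := @nonincreasing_cvg_mu _ _ _ m V (Voo 0%N) mV.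
rewrite capV => /(_ mF niV) cvgV.
have Ffin : m F \is a fin_num by rewrite ge0_fin_numE// mfin.
have : nbhs (m F) [set y | (y < m F + e%:E)%E].
  rewrite -(fineK Ffin) -EFinD.
  by apply: (@nbhs_open_ereal_lt R _ (fun=> _)); rewrite ltrDl.
move/cvgV => [n _ /(_ n (leqnn n))/= Vn].
have [x Fx|s [sP Fs]] := @compact_seq_cover G b F (fun i => b i `<=` V n) ob cF.
  have [i [bx bV]] := bP x _ (open_nbhs_nbhs (conj (oV n) (FV n x Fx))).
  by exists i.
exists s; split => //.
rewrite (@le_lt_trans _ _ (m (V n `\` F)))//.
  apply: le_measure; rewrite ?inE.
  - by apply: measurableD => //; apply: open_measurable_borel; exact: oW.
  - exact: measurableD.
  - by move=> x [[i /= /sP bV /bV Vx] nFx].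
have -> : m (V n `\` F) = (m (V n) - m F)%E.
  rewrite (measureD (mV n) mF (Voo n)); congr (_ + - m _)%E.
  exact/setIidPr/FV.
by rewrite lteBlDl.
Qed.

(** Countably many parameters are dense for the pseudo-distance given by the measure of the
    symmetric difference. The common compact set [C] is recorded because the functions to be
    integrated are only locally integrable. *)
Lemma compact_family_separable (E : R -> set G) (D : set R) : D !=set0 ->
  (forall T, D T -> compact (E T)) ->
  exists d : nat -> R, (forall n, D (d n)) /\
    forall T, D T -> exists (k : nat -> nat) (C : set G),
      [/\ compact C, forall n, E (d (k n)) `<=` C, E T `<=` C &
        m (symdiff (E (d (k n))) (E T)) @[n --> \oo] --> 0%E].
Proof.
move=> [T0 DT0] cE.
have [b [ob bP]] := second_countable_basis scG.
have [K [cK KP]] := compact_exhaustion lcG scG.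
pose W (s : seq nat) := \bigcup_(n in [set` s]) b n.
have mW s : measurable (W s : set (borel G)).
  by apply: open_measurable_borel; apply: bigcup_open => n _; exact: ob.
have mE T : D T -> measurable (E T : set (borel G)).
  by move=> DT; exact: compact_measurable_borel (cE T DT).
have msd (A B : set (borel G)) : measurable A -> measurable B ->
    measurable (symdiff A B).
  by move=> mA mB; apply: measurableU; exact: measurableD.
(* A code consists of a finite union of basic sets, a tolerance and a stage of the exhaustion. One
   parameter is chosen for each code that some parameter satisfies. *)
pose good (c : seq nat * nat * nat) T := [/\ D T, E T `<=` K c.2 &
  (m (symdiff (E T) (W c.1.1)) < (c.1.2.+1%:R^-1)%:E)%E].
have /choice[d dP] n : exists T, D T /\ forall c, unpickle n = Some c ->
    (exists T', good c T') -> good c T.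
  case: (unpickle n) => [c|]; last by exists T0.
  have [[T gT]|nT] := pselect (exists T', good c T').
    by exists T; split => [|_ [<-] _//]; case: gT.
  by exists T0; split => // _ [<-].
exists d; split => [n|T DT]; first by case: (dP n).
have [j Tj] := KP _ (cE T DT).
have /choice[s sP] n : exists s, E T `<=` W s /\
    (m (W s `\` E T) < (n.+1%:R^-1)%:E)%E.
  by apply: compact_outer_approx => //; exact: cE.
have sT n : (m (symdiff (E T) (W (s n))) < (n.+1%:R^-1)%:E)%E.
  rewrite /symdiff (_ : E T `\` _ = set0) ?set0U; first by case: (sP n).
  by rewrite setD_eq0; case: (sP n).
(* [E T] and [E (d (k n))] are both within [1/(n+1)] of the same [W (s n)], whence the factor 2 in
   the squeeze below. *)
pose k n := pickle (s n, n, j).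
have gk n : good (s n, n, j) (d (k n)).
  apply: (proj2 (dP (k n)) (s n, n, j)); first by rewrite pickleK.
  by exists T; split => //=; exact: sT.
exists k, (K j); split => // [n|]; first by case: (gk n).
apply: (@squeeze_cvge _ _ _ _ (cst 0%E) _
    (fun n => (2 * n.+1%:R^-1)%:E)).
- apply: nearW => n; rewrite measure_ge0/=.
  have [Dk _ /ltW lek] := gk n.
  apply: (@le_trans _ _ (m (symdiff (E (d (k n))) (W (s n))) +
      m (symdiff (E T) (W (s n))))%E).
    apply: (@le_trans _ _ (m (symdiff (E (d (k n))) (W (s n)) `|`
        symdiff (E T) (W (s n))))).
      apply: le_measure; rewrite ?inE.
      - by apply: msd; exact: mE.
      - by apply: measurableU; apply: msd => //; exact: mE.
      - move=> x; rewrite /symdiff/= => -[[Ak nA]|[A nAk]].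
          have [Wx|nWx] := pselect (W (s n) x); first by right; right.
          by left; left.
        have [Wx|nWx] := pselect (W (s n) x); first by left; right.
        by right; left.
    by apply: measureU2; apply: msd => //; exact: mE.
  rewrite mulr_natl mulr2n EFinD; apply: leeD => //; exact: ltW.
- exact: cvg_cst.
- apply/fine_cvgP; split; first exact: nearW.
  rewrite -[X in _ --> X](mulr0 2); apply: cvgMr; exact: cvg_harmonic.
Qed.

End lcsc_measure.

(** * Conditional expectations on invariant sets *)

Section cond_exp.
Context {R : realType} {G : Type} {dX} {X : measurableType dX}.
Variables (P : probability X R) (act : G -> X -> X).

Lemma invariant_sets_sigma_algebra : sigma_algebra setT (invariant_sets act).
Proof.
split=> [|A [mA Ainv]|A Ainv].
- by split => // g; rewrite preimage_set0.
- split=> [|g]; first exact: measurableD.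
  by rewrite !setTD -preimage_setC Ainv.
- split=> [|g]; first by apply: bigcup_measurable => k _; case: (Ainv k).
  rewrite preimage_bigcup; apply: eq_bigcup => // k _.
  by case: (Ainv k).
Qed.

Lemma cond_exp_cst (c : R) : is_cond_exp P (invariant_sets act) (cst c) (cst c).
Proof.
split => // [B mB|]; last exact: finite_measure_integrable_cst.
rewrite preimage_cst; case: ifPn => _; first by split => // g; rewrite preimage_setT.
by split => // g; rewrite preimage_set0.
Qed.

Lemma ergodic_cond_exp (f : X -> R) : ergodic P act ->
  P.-integrable setT (EFin \o f) ->
  is_cond_exp P (invariant_sets act) f (cst (fine (\int[P]_x (f x)%:E))).
Proof.
move=> erg intf; have [inv0 int0 _] := cond_exp_cst (fine (\int[P]_x (f x)%:E)).
split => // A Ainv; have [mA _] := Ainv.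
set c := fine _.
have -> : (\int[P]_(x in A) (cst c x)%:E = c%:E * P A)%E.
  by transitivity (\int[P]_(x in A) (cst c%:E x))%E => //; rewrite integral_cst.
rewrite /c fineK; last exact: integrable_fin_num.
have [PA|PA] := erg A Ainv.
  rewrite PA mule0 null_set_integral//.
  by apply: measurable_funTS; exact: measurable_int intf.
rewrite PA mule1 (@negligible_integral _ _ _ P setT (~` A))//.
- by congr (integral _ _ _); rewrite setTD setCK.
- exact: measurableC.
- by have := probability_setC P mA; rewrite PA subee.
Qed.

(** Radon-Nikodym for the charge with density [f], restricted to the invariant sigma-algebra.
    Restriction is a pushforward along the identity from [X] to [Y], the same space with fewer
    measurable sets; measurability of the density on [Y] is the required invariance. *)
Lemma cond_exp_exists (f : X -> R) : P.-integrable setT (EFin \o f) ->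
  exists h, is_cond_exp P (invariant_sets act) f h.
Proof.
move=> intf; pose Y : measurableType _ := g_sigma_algebraType (invariant_sets act).
have mYE : @measurable _ Y = invariant_sets act.
  exact: sigma_algebra_id invariant_sets_sigma_algebra.
pose i : X -> Y := id.
have mi : measurable_fun setT i.
  by move=> _ B; rewrite mYE => -[mB _]; rewrite setTI.
have [PY PYE] : exists PY : {measure set Y -> \bar R},
    (PY : set Y -> \bar R) = pushforward P i.
  by exists (@measure_function_pushforward__canonical__measure_function_Measure
    _ _ X Y R P i mi).
have PYT : PY setT = 1%E by rewrite PYE /pushforward preimage_setT probability_setT.
have PYsf : sigma_finite setT PY.
  by exists (fun=> setT) => [|_]; [rewrite bigcup_const//; exists 0%N|rewrite PYT ltry].
pose PY' := sigma_finite_pack PYsf.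
pose nu : {charge set Y -> \bar R} :=
  @measure_function_pushforward__canonical__charge_Charge _ _ X Y i R (induced_charge intf) mi.
have numu : nu `<< PY'.
  rewrite -[X in _ `<< X]/(PY : set Y -> \bar R) PYE.
  apply: (@dominates_pushforward _ _ _ _ R P (induced_charge intf) i mi).
  apply/null_content_dominatesP => A mA PA.
  rewrite /= /induced_charge null_set_integral//.
  by apply: measurable_funTS; exact: measurable_int intf.
pose h := Radon_Nikodym nu PY'.
have hfin y : h y \is a fin_num by exact: Radon_Nikodym_fin_num.
have inth : PY'.-integrable setT h by exact: Radon_Nikodym_integrable.
have hfE : (EFin \o (fun y => fine (h y))) = h.
  by apply/funext => y /=; rewrite fineK.
have inthX : P.-integrable setT h.
  apply/integrableP; split.
    exact: (measurableT_comp (measurable_int _ inth) mi).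
  have /integrableP[mh] := inth.
  rewrite (_ : integral PY' _ _ = integral (pushforward P i) setT (abse \o h)); last by rewrite -PYE.
  by rewrite ge0_integral_pushforward//; exact: measurableT_comp.
exists (fun y => fine (h y)); split.
- move=> B mB; suff : measurable ((fun y => fine (h y)) @^-1` B : set Y).
    by rewrite mYE.
  rewrite -[X in measurable X]setTI.
  have mh : measurable_fun [set: Y] (fun y => fine (h y)).
    by apply/measurable_EFinP; rewrite hfE; exact: measurable_int inth.
  exact: mh.
- by rewrite hfE.
- move=> A Ainv; have mA : measurable (A : set Y) by rewrite mYE.
  rewrite -[RHS]/(nu A) (Radon_Nikodym_integral numu mA) -/h.
  rewrite (_ : integral PY' _ _ = integral (pushforward P i) A h); last by rewrite -PYE.
  rewrite integral_pushforward//.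
  + by apply: eq_integral => x _; rewrite /= fineK.
  + exact: measurable_int inth.
  + by apply: integrableS inthX => //; case: Ainv.
Qed.

End cond_exp.

(** * Averages along orbits *)

Lemma ge0_ecvg0P {R : realType} {I : Type} (F : set_system I) {FF : Filter F}
    (f : I -> \bar R) : (forall i, (0 <= f i)%E) ->
  f @ F --> 0%E <-> forall e : R, 0 < e -> \forall i \near F, (f i <= e%:E)%E.
Proof.
move=> f0; split=> [f_0 e e0|fe].
  have : nbhs (0%:E : \bar R) [set y | (y < e%:E)%E].
    exact: (@nbhs_open_ereal_lt R _ (fun=> _)).
  by move/f_0 => fF; apply: (@filterS _ F _ _ _ _ fF) => i /ltW.
have ffin e i : (f i <= e%:E)%E -> f i \is a fin_num.
  by move=> fie; rewrite ge0_fin_numE// (le_lt_trans fie)// ltry.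
apply/fine_cvgP; split.
  by apply: filterS (fe 1 ltr01) => i; exact: ffin.
apply/cvgrPdist_le => e e0; apply: filterS (fe e e0) => i fie.
rewrite sub0r normrN ger0_norm ?fine_ge0//.
by rewrite -lee_fin fineK// (ffin e).
Qed.

Section Rintegral_symdiff.
Context {R : realType} {d} {T : measurableType d} (mu : {measure set T -> \bar R}).

(** Absolute continuity of the integral: the two integrals differ only by those over [A \ A_n] and
    [A_n \ A], sets of small measure. *)
Lemma Rintegral_symdiff_cvg (C A : set T) (A_ : nat -> set T) (phi : T -> R) :
  measurable C -> measurable A -> (forall n, measurable (A_ n)) ->
  A `<=` C -> (forall n, A_ n `<=` C) -> mu.-integrable C (EFin \o phi) ->
  mu (symdiff (A_ n) A) @[n --> \oo] --> 0%E ->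
  Rintegral mu (A_ n) phi @[n --> \oo] --> Rintegral mu A phi.
Proof.
move=> mC mA mA_ AC A_C intphi /ge0_ecvg0P cvgA.
have intB B : measurable B -> B `<=` C -> mu.-integrable B (EFin \o phi).
  by move=> mB BC; apply: integrableS intphi.
apply/cvgrPdist_lt => e e0.
have e20 : 0 < e / 2 by rewrite divr_gt0.
have intpsi : mu.-integrable setT (EFin \o (phi \_ C)).
  by rewrite -restrict_EFin; exact: (integrable_mkcond _ mC).1.
have [dlt [d0 dP]] := integral_normr_continuous intpsi e20.
have small B : measurable B -> B `<=` C -> (mu B < dlt%:E)%E ->
    `|Rintegral mu B phi| < e / 2.
  move=> mB BC muB; apply: le_lt_trans (dP B mB muB).
  apply: (le_trans (le_normr_Rintegral mB (intB B mB BC))).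
  rewrite le_eqVlt; apply/orP; left; apply/eqP.
  apply: eq_Rintegral => x; rewrite inE => Bx.
  by rewrite patchE mem_set//; exact: BC.
have split_int B B' : measurable B -> measurable B' -> B `<=` C ->
    Rintegral mu B phi = Rintegral mu (B `&` B') phi + Rintegral mu (B `\` B') phi.
  move=> mB mB' BC; rewrite -Rintegral_setU//.
  - by rewrite setUIDK.
  - exact: measurableI.
  - exact: measurableD.
  - by rewrite setUIDK; exact: intB.
  - by apply/eqP/seteqP; split => // x [[_ B'x] [_ /(_ B'x)]].
(* Convergence yields a non-strict bound; halving [dlt] makes it strict. *)
have d20 : 0 < dlt / 2 by rewrite divr_gt0.
have := cvgA (fun n => measure_ge0 mu _) _ d20.
apply: filterS => n mun.
have muD B : measurable B -> B `<=` symdiff (A_ n) A -> (mu B < dlt%:E)%E.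
  move=> mB BS; apply: (@le_lt_trans _ _ (dlt / 2)%:E); last first.
    by rewrite lte_fin ltr_pdivrMr// mulr_natr mulr2n ltrDl.
  apply: le_trans mun; apply: le_measure; rewrite ?inE//.
  by apply: measurableU; exact: measurableD.
rewrite (split_int A (A_ n))// (split_int (A_ n) A)// (setIC A).
rewrite opprD addrACA subrr add0r [e]splitr.
apply: (le_lt_trans (ler_normB _ _)); apply: ltrD; apply: small.
- exact: measurableD.
- by move=> x [/AC].
- by apply: muD; [exact: measurableD|move=> x Ax; right].
- exact: measurableD.
- by move=> x [/A_C].
- by apply: muD; [exact: measurableD|move=> x Ax; left].
Qed.

End Rintegral_symdiff.

Section averages.
Context {R : realType} {G : ptopologicalType}.
Variables (mul : G -> G -> G) (inv : G -> G) (one : G).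
Hypothesis hG : is_lcsc_group mul inv one.
Variable m : {measure set (borel G) -> \bar R}.
Hypothesis mfin : forall K : set G, compact K -> (m K < +oo)%E.

Let hausG : hausdorff_space G. Proof. by case: hG => _ _ _ _ []. Qed.
Let lcG : locally_compact [set: G]. Proof. by case: hG => _ _ _ _ []. Qed.
Let scG : @second_countable G. Proof. by case: hG => _ _ _ _ []. Qed.

Let mK (K : set G) : compact K -> measurable (K : set (borel G)).
Proof. exact: compact_measurable_borel. Qed.

Lemma continuous_measurable_borel (f : G -> G) : continuous f ->
  measurable_fun setT (f : borel G -> borel G).
Proof.
move=> cf; apply: (@measurability _ _ (borel G) (borel G) setT f (@open G)) => //.
move=> _ [B oB <-].
rewrite setTI; apply: open_measurable_borel.
by apply: open_comp => // x _; exact: cf.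
Qed.

Definition locally_integrable (phi : borel G -> R) :=
  forall C : set G, compact C -> m.-integrable C (EFin \o phi).

Let average (A : set G) (phi : borel G -> R) :=
  (fine (m A))^-1 * Rintegral m A phi.

(** Averages are continuous under convergence in measure inside a compact set, and a closed bound
    passes to the limit. The sequence [d] is chosen before [phi], so one sequence serves all orbits
    and all functions. *)
Lemma average_separable (E : R -> set G) (D : set R) : D !=set0 ->
  (forall T, D T -> compact (E T) /\ (0 < m (E T) < +oo)%E) ->
  exists d : nat -> R, (forall n, D (d n)) /\
    forall phi, locally_integrable phi -> forall c r : R,
      (forall n, `|average (E (d n)) phi - c| <= r) ->
      forall T, D T -> `|average (E T) phi - c| <= r.
Proof.
move=> D0 hE.
have [|d [Dd dP]] := compact_family_separable hausG lcG scG mfin D0 (E := E).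
  by move=> T /hE[].
exists d; split => // phi intphi c r dr T DT.
have [k [C [cC dC TC cvgE]]] := dP T DT.
have cint (psi : borel G -> R) : m.-integrable C (EFin \o psi) ->
    Rintegral m (E (d (k n))) psi @[n --> \oo] --> Rintegral m (E T) psi.
  move=> intpsi; apply: (@Rintegral_symdiff_cvg _ _ (borel G) m C (E T)
    (fun n => E (d (k n))) psi) => //; first exact: mK.
  - by apply: mK; case: (hE T DT).
  - by move=> n; apply: mK; case: (hE _ (Dd (k n))).
(* With the mass written as the integral of 1, [cint] also gives convergence of the normalizing
   factors. *)
have mE S : D S -> Rintegral m (E S) (cst 1) = fine (m (E S)).
  by move=> /hE[cE _]; rewrite (@Rintegral_cst _ _ _ m _ (mK cE) 1) mul1r.
have cvgm : fine (m (E (d (k n)))) @[n --> \oo] --> fine (m (E T)).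
  rewrite -mE//; under eq_fun do rewrite -mE//.
  apply: cint; apply/integrableP; split; first by apply/measurable_EFinP; exact: measurable_cst.
  rewrite /= normr1 integral_cst; last exact: mK.
  by rewrite mul1e mfin.
have mT0 : fine (m (E T)) != 0.
  have [_ /andP[mT0 mToo]] := hE T DT.
  by rewrite gt_eqF// fine_gt0// mT0.
have : `|average (E (d (k n))) phi - c| @[n --> \oo] --> `|average (E T) phi - c|.
  apply: cvg_norm; apply: cvgB; last exact: cvg_cst.
  by apply: cvgM; [exact: cvgV|apply: cint; exact: intphi].
move=> cvgk; rewrite -(cvg_lim _ cvgk)//; apply: limr_le.
  by apply/cvg_ex; eexists; exact: cvgk.
by apply: nearW => n; exact: dr.
Qed.

Section action.
Context {dX} {X : measurableType dX} (P : probability X R) (act : G -> X -> X).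
Hypothesis ha : mp_action mul one P act.

Let msf := sigma_finite_pack (lcsc_sigma_finite hausG lcG scG mfin).
(** The inverse matches [pi(g) f (x) = f (g^{-1} x)]. This map reverses products, but joint
    measurability and invariance of [P] are all that the orbit lemmas ask of it. *)
Let a (g : borel G) (x : X) := act (inv g) x.

Let ma : measurable_fun setT (fun gx : borel G * X => a gx.1 gx.2).
Proof.
case: ha => _ _ mact _ _.
have cinv : continuous inv by case: hG => _ _ _ [].
pose invX (gx : borel G * X) : borel G * X := (inv gx.1, gx.2).
have minvX : measurable_fun setT invX.
  apply/measurable_fun_pairP; split => /=; last exact: measurable_snd.
  exact: (measurableT_comp (continuous_measurable_borel cinv) measurable_fst).
exact: (measurableT_comp mact minvX).
Qed.

Let pa g A : measurable A -> P (a g @^-1` A) = P A.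
Proof. by case: ha => _ _ _ _ pact mA; exact: pact. Qed.

Lemma measurable_avg (K : set G) (f : X -> R) : compact K ->
  measurable_fun setT f -> measurable_fun setT (avg inv m K act f).
Proof.
move=> cK mf; apply: measurable_funM => //.
exact: (@measurable_orbit_Rintegral _ _ _ _ _ msf a ma f K mf (mK cK)).
Qed.

(** The exhaustion reduces all compact sets to countably many, hence to one null set of exceptional
    [x]. *)
Lemma orbit_locally_integrable (f : X -> R) : P.-integrable setT (EFin \o f) ->
  {ae P, forall x, locally_integrable (fun g => f (act (inv g) x))}.
Proof.
move=> intf; have [K [cK KP]] := compact_exhaustion lcG scG.
have : {ae P, forall x, forall n,
    m.-integrable (K n) (EFin \o (fun g : borel G => f (a g x)))}.
  apply: ae_foralln => n.
  exact: (@orbit_integrable _ _ _ _ _ msf P a ma pa f (K n) (mK (cK n))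
    (mfin (cK n)) intf).
apply: filterS => x intx C cC; have [n Cn] := KP C cC.
by apply: integrableS (intx n) => //; exact: mK.
Qed.

(** By [orbit_ae], almost every orbit meets the null set where the bounds fail in a null set of
    group elements, so the bounds survive integration. That null set is common to all [i], so [I]
    may be uncountable. *)
Lemma avg_dominated (I : Type) (D : set I) (q : I -> X -> R) (g : X -> R) :
  (forall i, D i -> measurable_fun setT (q i)) -> (forall x, 0 <= g x) ->
  P.-integrable setT (EFin \o g) ->
  {ae P, forall x, forall i, D i -> `|q i x| <= g x} ->
  {ae P, forall x, forall i, D i ->
    locally_integrable (fun u => q i (act (inv u) x)) /\
    forall K, compact K -> `|avg inv m K act (q i) x| <= avg inv m K act g x}.
Proof.
move=> mq g0 intg qg.
have mg : measurable_fun setT g by apply/measurable_EFinP; exact: measurable_int intg.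
have qga := @orbit_ae _ _ _ _ _ msf P a ma pa _ qg.
apply: filterS2 (orbit_locally_integrable intg) qga => x intx qgx i Di.
have mqx : measurable_fun [set: borel G] (fun u => q i (a u x)).
  exact: (measurableT_comp (mq i Di) (orbit_measurable ma x)).
have mgx : measurable_fun [set: borel G] (fun u => g (a u x)).
  exact: (measurableT_comp mg (orbit_measurable ma x)).
have leK K : compact K ->
    (\int[m]_(u in K) `|(q i (a u x))%:E| <= \int[m]_(u in K) (g (a u x))%:E)%E.
  move=> cK; apply: ae_ge0_le_integral => //.
  - exact: mK.
  - by apply: measurable_funTS; do 2 apply: measurableT_comp => //; exact/measurable_EFinP.
  - by move=> u _; rewrite lee_fin.
  - by apply: measurable_funTS; apply/measurable_EFinP.
  - by apply: filterS qgx => u /(_ i Di) qu _; rewrite lee_fin.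
have intq : locally_integrable (fun u => q i (act (inv u) x)).
  move=> C cC; apply/integrableP; split.
    by apply: measurable_funTS; apply/measurable_EFinP.
  apply: le_lt_trans (leK C cC) _.
  have /integrableP[_] := intx C cC.
  by under eq_integral do rewrite gee0_abs ?lee_fin ?g0//.
split => // K cK; rewrite /avg normrM ger0_norm ?invr_ge0 ?fine_ge0//.
apply: ler_wpM2l; first by rewrite invr_ge0 fine_ge0.
apply: (le_trans (le_normr_Rintegral (mK cK) (intq K cK))).
apply: fine_le; last exact: leK.
- rewrite integrable_fin_num//; first exact: mK.
  exact: (integrable_norm (intq K cK)).
- by rewrite integrable_fin_num//; [exact: mK|exact: intx].
Qed.

Lemma avg_cst (K : set G) (c : R) (x : X) : compact K -> (0 < m K)%E ->
  avg inv m K act (cst c) x = c.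
Proof.
move=> cK mK0; rewrite /avg Rintegral_cst; last exact: mK.
rewrite mulrCA mulVf ?mulr1// gt_eqF// fine_gt0//.
by rewrite mK0 mfin.
Qed.

End action.
End averages.

(** * Maximal functions *)

Lemma measurable_ereal_sup_range {R : realType} {d} {T : measurableType d}
    (u : nat -> T -> \bar R) : (forall n, measurable_fun setT (u n)) ->
  measurable_fun setT (fun x => ereal_sup (range (u ^~ x))).
Proof.
move=> mu; rewrite (_ : (fun x => _) = (fun x => esups (u ^~ x) 0)).
  exact: measurable_fun_esups.
apply/funext => x; rewrite /esups /sdrop; congr (ereal_sup _).
by apply/seteqP; split => _ [n _ <-]; exists n.
Qed.

Section maximal.
Context {R : realType} {G : ptopologicalType}.
Variables (mul : G -> G -> G) (inv : G -> G) (one : G).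
Hypothesis hG : is_lcsc_group mul inv one.
Variable m : {measure set (borel G) -> \bar R}.
Hypothesis mfin : forall K : set G, compact K -> (m K < +oo)%E.
Variable E : R -> set G.
Hypothesis hE : forall T : R, 0 < T -> compact (E T) /\ (0 < m (E T) < +oo)%E.
Hypothesis hA : good_averages mul inv one m E.
Context {dX} {X : measurableType dX} (P : probability X R) (act : G -> X -> X).
Hypothesis ha : mp_action mul one P act.

Let A (T : R) (f : X -> R) := avg inv m (E T) act f.

Let mA T f : 0 < T -> measurable_fun setT f -> measurable_fun setT (A T f).
Proof. by move=> /hE[cE _]; exact: (measurable_avg hG mfin ha). Qed.

(** The function [c] is arbitrary, being a constant at each [x]: [c = 0] serves the maximal
    function, a conditional expectation serves the tails. *)
Lemma avg_ereal_sup (D : set R) : D !=set0 -> (forall T, D T -> 0 < T) ->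
  exists d : nat -> R, (forall n, D (d n)) /\
    forall f c : X -> R, P.-integrable setT (EFin \o f) ->
      {ae P, forall x, forall T, D T -> ((`|A T f x - c x|)%:E <=
        ereal_sup (range (fun n => (`|A (d n) f x - c x|)%:E)))%E}.
Proof.
move=> D0 Dpos.
have [|d [Dd dP]] := average_separable hG mfin D0 (E := E).
  by move=> T /Dpos; exact: hE.
exists d; split => // f c intf.
apply: filterS (orbit_locally_integrable hG mfin ha intf) => x intx T DT.
set s := ereal_sup _.
have us n : ((`|A (d n) f x - c x|)%:E <= s)%E.
  by apply: ereal_sup_ubound; exists n.
have s0 : (0 <= s)%E by apply: le_trans (us 0%N); rewrite lee_fin.
have [->|soo] := eqVneq s +oo%E; first by rewrite leey.
have sfin : s \is a fin_num by rewrite ge0_fin_numE// ltey.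
rewrite -(fineK sfin) lee_fin; apply: (dP _ intx) => // n.
by rewrite -lee_fin fineK// us.
Qed.

(** The supremum [H] over a countable set of parameters is measurable, obeys the assumed maximal
    inequality and is therefore finite almost everywhere; its real part is a genuine L^p function
    that can be averaged again. *)
Lemma maximal_majorant (p : R) : 1 < p ->
  exists C : R, 0 <= C /\ forall f, in_Lp P p%:E f ->
    exists g : X -> R, [/\ forall x, 0 <= g x, in_Lp P p%:E g,
      (Lnorm P p%:E (EFin \o g) <= C%:E * Lnorm P p%:E (EFin \o f))%E &
      {ae P, forall x, forall T, 0 < T -> `|A T f x| <= g x}].
Proof.
move=> p1; have [[C hC] _] := hA ha p1.
have p0 : 0 < p by exact: lt_trans p1.
have [|//|d [d0 dP]] := @avg_ereal_sup [set T | 0 < T].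
  by exists 1; rewrite /= ltr01.
(* The assumed constant has no sign; the absolute value makes it usable in products of
   inequalities. *)
exists `|C|; split => // f fLp; have [mf ffin] := fLp.
have intf : P.-integrable setT (EFin \o f).
  by apply: in_Lp_integrable fLp; rewrite lee_fin ltW.
pose H x := ereal_sup (range (fun n => (`|A (d n) f x|)%:E)).
have mH : measurable_fun setT H.
  apply: measurable_ereal_sup_range => n; apply/measurable_EFinP.
  by apply: measurableT_comp => //; apply: mA => //; exact: d0.
have H0 x : (0 <= H x)%E.
  by apply: (@le_trans _ _ (`|A (d 0%N) f x|)%:E); rewrite ?lee_fin//;
    apply: ereal_sup_ubound; exists 0%N.
have LH : (Lnorm P p%:E H <= `|C|%:E * Lnorm P p%:E (EFin \o f))%E.
  apply: (@le_trans _ _ (C%:E * Lnorm P p%:E (EFin \o f))%E); last first.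
    by apply: lee_wpmul2r; rewrite ?Lnorm_ge0// lee_fin ler_norm.
  apply: le_trans (hC f fLp); apply: ae_le_Lnorm; first by rewrite lte_fin.
  apply/aeW => x; rewrite gee0_abs// (le_trans _ (lee_abs _))//.
  apply: ge_ereal_sup => _ [n _ <-]; apply: ereal_sup_ubound.
  by exists (d n) => //; exact: d0.
have LHoo : (Lnorm P p%:E H < +oo)%E.
  apply: le_lt_trans LH _; apply: lte_mul_pinfty => //.
have Hfin := Lnorm_lty_ae p0 mH LHoo.
have LgE : Lnorm P p%:E (EFin \o (fine \o H)) = Lnorm P p%:E H.
  apply: ae_eq_Lnorm; first by rewrite lte_fin.
  by apply: filterS Hfin => x Hx /=; rewrite fineK.
exists (fine \o H); split.
- by move=> x; exact: fine_ge0.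
- split; last by rewrite /finite_norm LgE.
  by apply: measurableT_comp => //; exact: fine_measurable.
- by rewrite LgE.
- apply: filterS2 Hfin (dP f (cst 0) intf) => x Hx fx T T0 /=.
  rewrite -lee_fin fineK//; have := fx T T0; rewrite subr0 => /le_trans; apply.
  apply: ge_ereal_sup => _ [n _ <-]; rewrite subr0.
  by apply: ereal_sup_ubound; exists n.
Qed.

(** Read off from the norm convergence: some [A T f] is within 1 of [h], and [A T f] is dominated by
    the L^p majorant, so Minkowski applies. *)
Lemma in_Lp_cond_exp (p : R) (f h : X -> R) : 1 < p -> in_Lp P p%:E f ->
  is_cond_exp P (invariant_sets act) f h -> in_Lp P p%:E h.
Proof.
move=> p1 fLp fh; have [mf ffin] := fLp.
have p0 : 0 < p by exact: lt_trans p1.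
have [hinv inth _] := fh.
have mh : measurable_fun setT h by apply/measurable_EFinP; exact: measurable_int inth.
split => //.
have [C [C0 /(_ f fLp)[g [g0 [mg gfin] _ fg]]]] := maximal_majorant p1.
have [_ /(_ f fLp h fh)[_ cvgL]] := hA ha p1.
have FF : Filter (pinfty_nbhs R) by exact: _.
have near1 := (@ge0_ecvg0P R R _ FF _ (fun T => Lnorm_ge0 _ _ _)).1 cvgL 1 ltr01.
have [T [T0 LT]] : exists T : R, 0 < T /\
    (Lnorm P p%:E (EFin \o (A T f \- h)%R) <= 1%:E)%E.
  have near0 : \forall T \near pinfty_nbhs R, 0 < T by exact: nbhs_pinfty_gt.
  have [T [T0 T1]] := filter_ex (filterI near0 near1).
  by exists T.
rewrite /finite_norm -(oppe_Lnorm P (EFin \o h)).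
have -> : (\- (EFin \o h))%E = EFin \o ((A T f \- h) \+ (\- (A T f)))%R.
  by apply/funext => x /=; rewrite addrAC subrr sub0r.
have mAT := mA T0 mf.
apply: le_lt_trans (eminkowski _ _ _ _) _.
- exact: measurable_funB.
- exact: measurableT_comp.
- by rewrite lee_fin ltW.
apply: lte_add_pinfty; first by apply: le_lt_trans LT _; rewrite ltry.
apply: le_lt_trans gfin; apply: ae_le_Lnorm; first by rewrite lte_fin.
apply: filterS fg => x /(_ T T0) fgx /=.
by rewrite lee_fin normrN (le_trans fgx)// ler_norm.
Qed.

(** The tail suprema [H n] of [|A T f - h|] over [T > n] tend to 0 almost everywhere and are
    dominated by [g + |h|]; dominated convergence of the p-th powers makes their norms small. *)
Lemma avg_tail_majorant (p : R) (f h : X -> R) : 1 < p -> in_Lp P p%:E f ->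
  is_cond_exp P (invariant_sets act) f h -> forall e : R, 0 < e ->
  exists (N : R) (g : X -> R), [/\ 0 <= N, forall x, 0 <= g x, in_Lp P p%:E g,
    (Lnorm P p%:E (EFin \o g) <= e%:E)%E &
    {ae P, forall x, forall T, N < T -> `|A T f x - h x| <= g x}].
Proof.
move=> p1 fLp fh e e0; have [mf ffin] := fLp.
have p0 : 0 < p by exact: lt_trans p1.
have [mh hfin] := in_Lp_cond_exp p1 fLp fh.
have intf : P.-integrable setT (EFin \o f).
  by apply: in_Lp_integrable fLp; rewrite lee_fin ltW.
have [C [C0 /(_ f fLp)[g [g0 [mg gfin] _ fg]]]] := maximal_majorant p1.
have [_ /(_ f fLp h fh)[cvgh _]] := hA ha p1.
(* Each tail needs its own countable set of parameters, all lying beyond [n]. *)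
have /choice[d dP] (n : nat) : exists d : nat -> R, (forall k, n%:R < d k) /\
    {ae P, forall x, forall T, n%:R < T -> ((`|A T f x - h x|)%:E <=
        ereal_sup (range (fun k => (`|A (d k) f x - h x|)%:E)))%E}.
  have [||d [dn dP]] := @avg_ereal_sup [set T | n%:R < T].
  - by exists n.+1%:R; rewrite /= ltr_nat.
  - by move=> T; apply: le_lt_trans.
  by exists d; split => //; exact: dP.
have d0 n k : 0 < d n k by apply: (@le_lt_trans _ _ n%:R) => //; case: (dP n).
pose H n x := ereal_sup (range (fun k => (`|A (d n k) f x - h x|)%:E)).
have mH n : measurable_fun setT (H n).
  apply: measurable_ereal_sup_range => k; apply/measurable_EFinP.
  by apply: measurableT_comp => //; apply: measurable_funB => //; exact: mA.
have H0 n x : (0 <= H n x)%E.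
  by apply: (@le_trans _ _ (`|A (d n 0%N) f x - h x|)%:E); rewrite ?lee_fin//;
    apply: ereal_sup_ubound; exists 0%N.
pose G0 x := g x + `|h x|.
have mG0 : measurable_fun setT G0.
  by apply: measurable_funD => //; exact: measurableT_comp.
have G0fin : finite_norm P p%:E G0.
  apply: le_lt_trans (eminkowski _ _ _ _) _ => //.
  - exact: measurableT_comp.
  - by rewrite lee_fin ltW.
  apply: lte_add_pinfty => //.
  by rewrite (_ : EFin \o _ = abse \o (EFin \o h))// Lnorm_abse.
have HG0 : {ae P, forall x, forall n, (H n x <= (G0 x)%:E)%E}.
  apply: filterS fg => x fgx n; apply: ge_ereal_sup => _ [k _ <-].
  rewrite lee_fin (le_trans (ler_normB _ _))// lerD2r; exact: fgx.
have HK : {ae P, forall x, forall n, (fine (H n x))%:E = H n x}.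
  apply: filterS HG0 => x Hx n; rewrite fineK// ge0_fin_numE//.
  by apply: le_lt_trans (Hx n) _; rewrite ltry.
have mfH n : measurable_fun setT (fine \o H n).
  by apply: measurableT_comp => //; exact: fine_measurable.
pose f_ n x := ((fine (H n x)) `^ p)%:E.
have mf_ n : measurable_fun setT (f_ n).
  apply/measurable_EFinP.
  by have := measurableT_comp (measurable_powR p) (mfH n).
have cvgf_ : {ae P, forall x, setT x -> f_ ^~ x @ \oo --> cst 0%E x}.
  apply: filterS2 HK cvgh => x Hx cvgx _.
  apply/ge0_ecvg0P => [n|r r0]; first by rewrite lee_fin powR_ge0.
  have rp0 : 0 < r `^ p^-1 by rewrite powR_gt0.
  move/cvgrPdist_le : cvgx => /(_ _ rp0)[M [_ MP]].
  near=> n; rewrite lee_fin.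
  have -> : r = (r `^ p^-1) `^ p.
    by rewrite -powRrM mulVf ?powRr1 ?gt_eqF// ltW.
  apply: ge0_ler_powR.
  - exact: ltW.
  - by rewrite nnegrE fine_ge0.
  - by rewrite nnegrE ltW.
  rewrite -lee_fin Hx; apply: ge_ereal_sup => _ [k _ <-].
  rewrite lee_fin distrC; apply: MP.
  apply: (@lt_trans _ _ n%:R); last by case: (dP n).
  by near: n; exact: nbhs_infty_gtr.
have intG0 : P.-integrable setT (fun x => ((G0 x) `^ p)%:E).
  apply/integrableP; split.
    apply/measurable_EFinP.
    exact: (measurableT_comp (measurable_powR p)).
  move: G0fin; rewrite /finite_norm => /(poweR_lty p).
  rewrite poweR_Lnorm ?gt_eqF//; apply: le_lt_trans.
  rewrite le_eqVlt; apply/orP; left; apply/eqP; apply: eq_integral => x _ /=.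
  by rewrite ger0_norm ?powR_ge0// ger0_norm// addr_ge0.
have domf_ : {ae P, forall x, forall n, setT x -> (`|f_ n x| <= ((G0 x) `^ p)%:E)%E}.
  apply: filterS2 HG0 HK => x HGx HKx n _.
  rewrite gee0_abs ?lee_fin ?powR_ge0//; apply: ge0_ler_powR.
  - exact: ltW.
  - by rewrite nnegrE fine_ge0.
  - by rewrite nnegrE addr_ge0.
  - by rewrite -lee_fin HKx.
have [_ _] := dominated_convergence measurableT mf_ (measurable_cst _) cvgf_ intG0 domf_.
have intf_0 n : (0 <= \int[P]_x f_ n x)%E.
  by apply: integral_ge0 => x _; rewrite lee_fin powR_ge0.
rewrite integral0 => /(ge0_ecvg0P intf_0) cvgint.
have ep0 : 0 < e `^ p by rewrite powR_gt0.
have [n _ /(_ n (leqnn n)) intn] : \forall n \near \oo,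
    (\int[P]_x f_ n x <= (e `^ p)%:E)%E by exact: cvgint.
have LHn : (Lnorm P p%:E (EFin \o (fine \o H n)) <= e%:E)%E.
  have -> : e%:E = ((e `^ p)%:E `^ p^-1)%E.
    by rewrite poweR_EFin -powRrM mulfV ?gt_eqF// powRr1// ltW.
  rewrite unlock; apply: gt0_ler_poweR.
  - by rewrite invr_ge0 ltW.
  - by rewrite in_itv/= leey andbT integral_ge0// => x _; exact: poweR_ge0.
  - by rewrite in_itv/= leey andbT lee_fin powR_ge0.
  apply: le_trans intn; rewrite le_eqVlt; apply/orP; left; apply/eqP.
  by apply: eq_integral => x _ /=; rewrite ger0_norm ?fine_ge0.
exists n%:R, (fine \o H n); split => //.
- by move=> x; exact: fine_ge0.
- by split => //; rewrite /finite_norm (le_lt_trans LHn)// ltry.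
- apply: filterS2 HK (dP n).2 => x HKx dx T nT.
  by rewrite -lee_fin /= HKx; exact: dx.
Unshelve. all: by end_near. Qed.

End maximal.

(** * Double averages *)

Section double_averages.
Context {R : realType} {U V : ptopologicalType}.
Variables (mulU : U -> U -> U) (invU : U -> U) (oneU : U).
Hypothesis hU : is_lcsc_group mulU invU oneU.
Variables (mulV : V -> V -> V) (invV : V -> V) (oneV : V).
Hypothesis hV : is_lcsc_group mulV invV oneV.
Variables (mU : {measure set (borel U) -> \bar R}).
Variables (mV : {measure set (borel V) -> \bar R}).
Hypothesis mUfin : forall K : set U, compact K -> (mU K < +oo)%E.
Hypothesis mVfin : forall K : set V, compact K -> (mV K < +oo)%E.
Variables (E : R -> set U) (F : R -> set V).
Hypothesis hE : forall T : R, 0 < T -> compact (E T) /\ (0 < mU (E T) < +oo)%E.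
Hypothesis hF : forall S : R, 0 < S -> compact (F S) /\ (0 < mV (F S) < +oo)%E.
Hypothesis hA : good_averages mulU invU oneU mU E.
Hypothesis hB : good_averages mulV invV oneV mV F.
Context {dX} {X : measurableType dX} (P : probability X R).
Variables (actU : U -> X -> X) (actV : V -> X -> X).
Hypothesis haU : mp_action mulU oneU P actU.
Hypothesis haV : mp_action mulV oneV P actV.

Let A (T : R) := avg invU mU (E T) actU.
Let B (S : R) := avg invV mV (F S) actV.
Let AB := ATBS invU invV mU mV E F actU actV.

Let mA T f : 0 < T -> measurable_fun setT f -> measurable_fun setT (A T f).
Proof. by move=> /hE[cE _]; exact: (measurable_avg hU mUfin haU). Qed.

Let mB S f : 0 < S -> measurable_fun setT f -> measurable_fun setT (B S f).
Proof. by move=> /hF[cF _]; exact: (measurable_avg hV mVfin haV). Qed.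

Lemma double_maximal (p : R) : 1 < p ->
  exists C : R, forall f : X -> R, in_Lp P p%:E f ->
  (Lnorm P p%:E (maxfun [set TS : R * R | (0 < TS.1)%R /\ (0 < TS.2)%R] (AB f))
    <= C%:E * Lnorm P p%:E (EFin \o f))%E.
Proof.
move=> p1.
have [CU [CU0 maxU]] := maximal_majorant hU mUfin hE hA haU p1.
have [CV [CV0 maxV]] := maximal_majorant hV mVfin hF hB haV p1.
exists (CU * CV) => f fLp.
have [g [g0 gLp gf Bg]] := maxV f fLp.
have [k [k0 kLp kg Ak]] := maxU g gLp.
have intg : P.-integrable setT (EFin \o g).
  by apply: in_Lp_integrable gLp; rewrite lee_fin ltW.
have := @avg_dominated _ _ _ _ _ hU _ mUfin _ _ P actU haU R [set S | 0 < S]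
  (fun S => B S f) g.
move=> /(_ (fun S S0 => mB S0 (proj1 fLp)) g0 intg Bg) ABg.
apply: (@le_trans _ _ (Lnorm P p%:E (EFin \o k))); last first.
  apply: (le_trans kg); rewrite EFinM -muleA; apply: lee_wpmul2l => //.
apply: ae_le_Lnorm; first by rewrite lte_fin (lt_trans _ p1).
apply: filterS2 ABg Ak => x ABx Ax /=.
(* A supremum over no index would be [-oo]; the pair [(1, 1)] makes it nonnegative. *)
have sup_ge0 : (0 <= maxfun [set TS : R * R | (0 < TS.1)%R /\ (0 < TS.2)%R] (AB f) x)%E.
  apply: (@le_trans _ _ (`|AB f (1, 1) x|)%:E); first by rewrite lee_fin.
  by apply: ereal_sup_ubound; exists (1, 1) => //=; rewrite ltr01.
rewrite gee0_abs//; apply: ge_ereal_sup => _ [[T S] /= [T0 S0] <-].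
have [_ /(_ (E T) (hE T0).1) ABT] := ABx S S0.
rewrite lee_fin (le_trans ABT)// (le_trans (ler_norm _))// (le_trans (Ax T T0))//.
exact: ler_norm.
Qed.

(** The essential supremum of [|f|] is a constant majorant, and averaging fixes constants:
    domination is applied first along [V], then along [U]. *)
Lemma double_maximal_oo (f : X -> R) : in_Lp P +oo%E f ->
  (Lnorm P +oo%E (maxfun [set TS : R * R | (0 < TS.1)%R /\ (0 < TS.2)%R] (AB f))
    <= Lnorm P +oo%E (EFin \o f))%E.
Proof.
move=> [mf ffin].
have PT0 : (0 < P setT)%E by rewrite probability_setT.
set r := Lnorm P +oo%E (EFin \o f).
have rfin : r \is a fin_num by rewrite ge0_fin_numE// Lnorm_ge0.
have r0 : 0 <= fine r by rewrite fine_ge0// Lnorm_ge0.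
(* The one-point index type puts a single function in the form of the family in [avg_dominated]. *)
have fr : {ae P, forall x, unit -> True -> `|f x| <= fine r}.
  have := ess_sup_ge P (abse \o (EFin \o f)).
  rewrite (_ : ess_sup _ _ = r); last by rewrite /r unlock PT0.
  by apply: filterS => x /= fx _ _; rewrite -lee_fin fineK.
have intr : P.-integrable setT (EFin \o cst (fine r)).
  exact: finite_measure_integrable_cst.
have Bf := @avg_dominated _ _ _ _ _ hV _ mVfin _ _ P actV haV unit (fun=> True)
  (fun=> f) (cst (fine r)) (fun _ _ => mf) (fun=> r0) intr fr.
have Br : {ae P, forall x, forall S, 0 < S -> `|B S f x| <= fine r}.
  apply: filterS Bf => x /(_ tt I)[_ Bx] S S0; have [cF /andP[F0 _]] := hF S0.
  by apply: le_trans (Bx _ cF) _; rewrite (avg_cst hV mVfin).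
have ABf := @avg_dominated _ _ _ _ _ hU _ mUfin _ _ P actU haU R [set S | 0 < S]
  (fun S => B S f) (cst (fine r)) (fun S S0 => mB S0 mf) (fun=> r0) intr Br.
rewrite unlock PT0; apply/ess_supP.
apply: filterS ABf => x ABx /=.
have sup_ge0 : (0 <= maxfun [set TS : R * R | (0 < TS.1)%R /\ (0 < TS.2)%R] (AB f) x)%E.
  apply: (@le_trans _ _ (`|AB f (1, 1) x|)%:E); first by rewrite lee_fin.
  by apply: ereal_sup_ubound; exists (1, 1) => //=; rewrite ltr01.
rewrite gee0_abs//; apply: ge_ereal_sup => _ [[T S] /= [T0 S0] <-].
have [cE /andP[E0 _]] := hE T0.
have [_ /(_ (E T) cE) ABT] := ABx S S0.
by rewrite -(fineK rfin) lee_fin (le_trans ABT)// (avg_cst hU mUfin).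
Qed.

(** * Almost everywhere and norm convergence of the double averages *)

Section convergence.
Variables (p : R) (f gV g : X -> R).
Hypotheses (p1 : 1 < p) (fLp : in_Lp P p%:E f).
Hypothesis fgV : is_cond_exp P (invariant_sets actV) f gV.
Hypothesis gVg : is_cond_exp P (invariant_sets actU) gV g.

Let p0 : 0 < p. Proof. exact: lt_trans p1. Qed.

Let gVLp : in_Lp P p%:E gV.
Proof. exact: (in_Lp_cond_exp hV mVfin hF hB haV p1 fLp fgV). Qed.

Let gLp : in_Lp P p%:E g.
Proof. exact: (in_Lp_cond_exp hU mUfin hE hA haU p1 gVLp gVg). Qed.

Lemma double_tail_majorant (e : R) : 0 < e ->
  exists (N : R) (M : X -> R), [/\ 0 <= N, forall x, 0 <= M x, in_Lp P p%:E M,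
    (Lnorm P p%:E (EFin \o M) <= e%:E)%E &
    {ae P, forall x, forall T S, 0 < T -> N < S ->
      `|AB f (T, S) x - A T gV x| <= M x}].
Proof.
move=> e0; have [CU [CU0 maxU]] := maximal_majorant hU mUfin hE hA haU p1.
(* The added 1 covers [CU = 0]; the maximal inequality then brings the bound back below [e]. *)
have e'0 : 0 < e / (CU + 1) by rewrite divr_gt0// ltr_wpDl.
have [N [h [N0 h0 hLp he Bh]]] :=
  avg_tail_majorant hV mVfin hF hB haV p1 fLp fgV e'0.
have [M [M0 MLp Mh AM]] := maxU h hLp.
exists N, M; split => //.
  apply: (le_trans Mh); apply: (@le_trans _ _ (CU%:E * (e / (CU + 1))%:E)%E).
    exact: lee_wpmul2l.
  rewrite -EFinM lee_fin mulrCA -[leRHS]mulr1; apply: ler_wpM2l; first exact: ltW.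
  by rewrite ler_pdivrMr ?ltr_wpDl// mul1r lerDl.
have integ k : in_Lp P p%:E k -> P.-integrable setT (EFin \o k).
  by apply: in_Lp_integrable; rewrite lee_fin ltW.
have mq S : N < S -> measurable_fun setT (B S f \- gV).
  move=> NS; apply: measurable_funB; last by case: gVLp.
  by apply: mB; [exact: le_lt_trans NS|case: fLp].
have ABh := @avg_dominated _ _ _ _ _ hU _ mUfin _ _ P actU haU R [set S | N < S]
  (fun S => B S f \- gV) h mq h0 (integ h hLp) Bh.
have intgV := orbit_locally_integrable hU mUfin haU (integ gV gVLp).
move: AM; apply: filterS3 ABh intgV => x ABx intx Ax T S T0 NS.
have [cE _] := hE T0; have mE := compact_measurable_borel
  (let: And5 _ _ _ _ (And3 hs _ _) := hU in hs) cE.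
have [intq /(_ _ cE) ABT] := ABx S NS.
(* Linearity of [A T] along this orbit, where [B S f - gV] and [gV] are both locally integrable. *)
suff -> : AB f (T, S) x - A T gV x = A T (B S f \- gV) x.
  by rewrite (le_trans ABT)// (le_trans (ler_norm _))// Ax.
rewrite /AB /ATBS /A /avg -mulrBr; congr (_ * _).
apply/eqP; rewrite subr_eq; apply/eqP; rewrite -RintegralD//.
- by apply: eq_Rintegral => u _; rewrite /= subrK.
- exact: intq.
- exact: intx.
Qed.

(** The majorants with norm at most [1/(n+1)] have a pointwise infimum [J] of norm 0, so [J = 0]
    almost everywhere. At such [x] some majorant is below [e / 2], and [A T gV] converging to [g]
    supplies the other half. *)
Lemma double_cvg_ae : {ae P, forall x, (fun TS => AB f TS x) @ @pinfty2 R --> g x}.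
Proof.
have /choice[NM NMP] (n : nat) : exists NM : R * (X -> R),
    [/\ forall x, 0 <= NM.2 x, in_Lp P p%:E NM.2,
      (Lnorm P p%:E (EFin \o NM.2) <= (n.+1%:R^-1)%:E)%E &
      {ae P, forall x, forall T S, 0 < T -> NM.1 < S ->
        `|AB f (T, S) x - A T gV x| <= NM.2 x}].
  have n0 : 0 < n.+1%:R^-1 :> R by [].
  by have [N [M []]] := double_tail_majorant n0; exists (N, M).
pose J x := ereal_inf (range (fun n => ((NM n).2 x)%:E)).
have J0 x : (0 <= J x)%E.
  by apply: le_ereal_inf_tmp => _ [n _ <-]; rewrite lee_fin; case: (NMP n).
have mJ : measurable_fun setT J.
  rewrite (_ : J = fun x => (- ereal_sup (range (fun n => - ((NM n).2 x)%:E)))%E).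
    apply: measurableT_comp => //; apply: measurable_ereal_sup_range => n.
    apply: measurableT_comp => //; apply/measurable_EFinP.
    by case: (NMP n) => _ [].
  apply/funext => x; rewrite /J /ereal_inf; congr (- ereal_sup _)%E.
  by rewrite image_comp.
have LJ : Lnorm P p%:E J = 0%E.
  apply/eqP; rewrite eq_le Lnorm_ge0 andbT.
  apply/lee_addgt0Pr => e e0; rewrite add0e.
  have [n _ /(_ n (leqnn n))/= ne] := near_infty_natSinv_lt (PosNum e0).
  have [M0 _ Mn _] := NMP n.
  apply: (@le_trans _ _ (Lnorm P p%:E (EFin \o (NM n).2))).
    apply: ae_le_Lnorm => //; apply/aeW => x.
    rewrite gee0_abs// gee0_abs ?lee_fin//.
    by apply: ereal_inf_lbound; exists n.
  by apply: (le_trans Mn); rewrite lee_fin ltW.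
have Jae := Lnorm_eq0_eq0 mJ (p0 : (0 < p%:E)%E) LJ.
have NMae : {ae P, forall x, forall n T S, 0 < T -> (NM n).1 < S ->
    `|AB f (T, S) x - A T gV x| <= (NM n).2 x}.
  by apply: ae_foralln => n; case: (NMP n).
have [_ /(_ gV gVLp g gVg)[Acvg _]] := hA haU p1.
move: Jae; apply: filterS3 NMae Acvg => x NMx Ax /(_ I)/= Jx.
apply/cvgrPdist_le => e e0.
have e20 : 0 < e / 2 by rewrite divr_gt0.
have : (J x < (e / 2)%:E)%E by rewrite Jx lte_fin.
move=> /ereal_inf_lt[_ [n _ <-]]; rewrite lte_fin => Mne.
move/cvgrPdist_le : Ax => /(_ _ e20) Ax.
exists ([set T | 0 < T /\ `|g x - A T gV x| <= e / 2], [set S | (NM n).1 < S]).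
  split; last by apply: nbhs_pinfty_gt; exact: num_real.
  by apply: filterI => //; exact: nbhs_pinfty_gt.
move=> [T S] /= [[T0 AT] NS].
rewrite (_ : g x - _ = (g x - A T gV x) - (AB f (T, S) x - A T gV x)); last first.
  by rewrite opprB addrA subrK.
rewrite (le_trans (ler_normB _ _))// [leRHS]splitr lerD//.
by rewrite (le_trans (NMx n T S T0 NS))// ltW.
Qed.

Lemma double_cvg_Lp :
  (fun TS => Lnorm P p%:E (EFin \o (AB f TS \- g)%R)) @ @pinfty2 R --> 0%E.
Proof.
have FF : Filter (@pinfty2 R) by exact: filter_prod_filter.
apply/ge0_ecvg0P => [TS|e e0]; first exact: Lnorm_ge0.
have e20 : 0 < e / 2 by rewrite divr_gt0.
have [N [M [N0 M0 MLp Me ABM]]] := double_tail_majorant e20.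
have [_ /(_ gV gVLp g gVg)[_ Acvg]] := hA haU p1.
have F1 : Filter (pinfty_nbhs R) by exact: _.
have Ae := (@ge0_ecvg0P R R _ F1 _ (fun T => Lnorm_ge0 _ _ _)).1 Acvg _ e20.
exists ([set T | 0 < T /\
    (Lnorm P p%:E (EFin \o (A T gV \- g)%R) <= (e / 2)%:E)%E], [set S | N < S]).
  split; last by apply: nbhs_pinfty_gt; exact: num_real.
  by apply: filterI => //; exact: nbhs_pinfty_gt.
move=> [T S] /= [[T0 AT] NS].
have mABf : measurable_fun setT (AB f (T, S)).
  by apply: mA => //; apply: mB; [exact: le_lt_trans NS|case: fLp].
have mAg : measurable_fun setT (A T gV) by apply: mA => //; case: gVLp.
have mg : measurable_fun setT g by case: gLp.
rewrite (_ : (AB f (T, S) \- g) = (AB f (T, S) \- A T gV) \+ (A T gV \- g))%R;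
  last by apply/funext => x /=; rewrite addrA subrK.
apply: le_trans (eminkowski _ _ _ _) _.
- exact: measurable_funB.
- exact: measurable_funB.
- by rewrite lee_fin ltW.
rewrite [e]splitr EFinD; apply: leeD => //.
apply: le_trans Me; apply: ae_le_Lnorm => //.
apply: filterS ABM => x /(_ T S T0 NS) ABx /=.
by rewrite lee_fin (le_trans ABx)// ler_norm.
Qed.

End convergence.
End double_averages.

(** * The three assertions assembled *)

Unset Implicit Arguments.
Set Strict Implicit.
Set Printing Implicit Defensive.

Theorem theorem7p5 (R : realType)
  (U : ptopologicalType) (mulU : U -> U -> U) (invU : U -> U) (oneU : U)
  (hU : is_lcsc_group mulU invU oneU)
  (V : ptopologicalType) (mulV : V -> V -> V) (invV : V -> V) (oneV : V)
  (hV : is_lcsc_group mulV invV oneV)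
  (mU : {measure set (borel U) -> \bar R}) (hmU : is_left_haar mulU mU)
  (mV : {measure set (borel V) -> \bar R}) (hmV : is_left_haar mulV mV)
  (E : R -> set U) (F : R -> set V)
  (hE : forall T : R, 0 < T -> compact (E T) /\ (0 < mU (E T) < +oo)%E)
  (hF : forall S : R, 0 < S -> compact (F S) /\ (0 < mV (F S) < +oo)%E)
  (hFolner : forall v : V,
     fine (mV (symdiff [set mulV w v | w in F S] (F S))) / fine (mV (F S))
       @[S --> +oo] --> 0)
  (hA : good_averages mulU invU oneU mU E)
  (hB : good_averages mulV invV oneV mV F)
  (dX : measure_display) (X : measurableType dX) (m : probability X R)
  (actU : U -> X -> X) (actV : V -> X -> X)
  (haU : mp_action mulU oneU m actU) (haV : mp_action mulV oneV m actV) :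
  (* (1) maximal inequality, 1 < p <= oo *)
  (forall p : \bar R, (1 < p)%E -> exists C : R, forall f : X -> R, in_Lp m p f ->
     (Lnorm m p (maxfun [set TS : R * R | (0 < TS.1)%R /\ (0 < TS.2)%R]
                        (ATBS invU invV mU mV E F actU actV f))
        <= C%:E * Lnorm m p (EFin \o f))%E) /\
  (* (2) convergence a.e. and in L^p to U V f, 1 < p < oo *)
  (forall p : R, 1 < p -> forall f : X -> R, in_Lp m p%:E f ->
   forall gV : X -> R, is_cond_exp m (invariant_sets actV) f gV ->
   forall g : X -> R, is_cond_exp m (invariant_sets actU) gV g ->
     {ae m, forall x, (fun TS => ATBS invU invV mU mV E F actU actV f TS x)
                        @ @pinfty2 R --> g x} /\
     (fun TS => Lnorm m p%:E (EFin \o (ATBS invU invV mU mV E F actU actV f TS \- g)))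
        @ @pinfty2 R --> 0%E) /\
  (* (3) ergodic case: the limit is the space average *)
  (ergodic m actU \/ ergodic m actV ->
   forall p : R, 1 < p -> forall f : X -> R, in_Lp m p%:E f ->
     {ae m, forall x, (fun TS => ATBS invU invV mU mV E F actU actV f TS x)
                        @ @pinfty2 R --> fine (\int[m]_y (f y)%:E)} /\
     (fun TS => Lnorm m p%:E (EFin \o (ATBS invU invV mU mV E F actU actV f TS
                                      \- cst (fine (\int[m]_y (f y)%:E)))))
        @ @pinfty2 R --> 0%E).
Proof.
have mUfin : forall K : set U, compact K -> (mU K < +oo)%E by case: hmU.
have mVfin : forall K : set V, compact K -> (mV K < +oo)%E by case: hmV.
have cvg12 p : 1 < p -> forall f, in_Lp m p%:E f ->
    forall gV, is_cond_exp m (invariant_sets actV) f gV ->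
    forall g, is_cond_exp m (invariant_sets actU) gV g ->
    {ae m, forall x, (fun TS => ATBS invU invV mU mV E F actU actV f TS x)
                        @ @pinfty2 R --> g x} /\
     (fun TS => Lnorm m p%:E (EFin \o (ATBS invU invV mU mV E F actU actV f TS \- g)))
        @ @pinfty2 R --> 0%E.
  move=> p1 f fLp gV fgV g gVg; split.
    exact: (double_cvg_ae hU hV mUfin mVfin hE hF hA hB haU haV p1 fLp fgV gVg).
  exact: (double_cvg_Lp hU hV mUfin mVfin hE hF hA hB haU haV p1 fLp fgV gVg).
split; [|split => //].
  move=> [p|_|//]; last first.
    exists 1 => f fLp; rewrite mul1e.
    exact: (double_maximal_oo hU hV mUfin mVfin hE hF haU haV fLp).
  rewrite lte_fin => p1.
  exact: (double_maximal hU hV mUfin mVfin hE hF hA hB haU haV p1).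
move=> erg p p1 f fLp.
have intf : m.-integrable setT (EFin \o f).
  by apply: in_Lp_integrable fLp; rewrite lee_fin ltW.
case: erg => [ergU|ergV]; last first.
  (* For ergodic [V] the inner conditional expectation is already the space average, which the outer
     one fixes. *)
  apply: cvg12 => //; first exact: (ergodic_cond_exp ergV intf).
  exact: cond_exp_cst.
(* For ergodic [U] the outer conditional expectation is the mean of [gV], equal to that of [f]
   because the whole space is an invariant set. *)
have [gV fgV] := cond_exp_exists actV intf.
have [_ intgV gVf] := fgV.
apply: (cvg12 p p1 f fLp gV fgV).
have <- : (\int[m]_y (gV y)%:E = \int[m]_y (f y)%:E)%E.
  by apply: gVf; split => // g; rewrite preimage_setT.
exact: ergodic_cond_exp.
Qed.
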